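(* Let $\lVert\cdot\rVert$ be a strictly convex norm on $\mathbb{R}^2$, let $n\geq 2$, and let $P=\{p_1,\ldots,p_n\}\subset\mathbb{R}^2$ be a set of $n$ points. Then the Shamos--Hoey algorithm (as specified step by step in the context), applied to $P$, computes the center and the radius of the minimal enclosing disk of $P$; that is, the pair it returns consists of the center and the radius of the minimal enclosing disk of $P$.
   Context: A norm $\lVert\cdot\rVert$ on $\mathbb{R}^2$ is strictly convex if $\lVert x+y\rVert<2$ whenever $\lVert x\rVert=\lVert y\rVert=1$ and $x\neq y$. Write $B(x,\lambda)=\{y\in\mathbb{R}^2 : \lVert y-x\rVert\leq\lambda\}$ for the disk with center $x$ and radius $\lambda$. For a compact set $P\subset\mathbb{R}^2$ put $R(P)=\inf_{x\in\mathbb{R}^2}\max_{p\in P}\lVert x-p\rVert$. A minimal enclosing disk of $P$ is a disk $B(\bar{x},\bar{\lambda})$ with $\bar{\lambda}=R(P)$ and $P\subset B(\bar{x},\bar{\lambda})$. It exists, and for strictly convex norms it is unique (known). The two-point disk of $p,p'$ is $B\left(\frac{1}{2}(p+p'),\frac{1}{2}\lVert p-p'\rVert\right)$. For a finite set $P\subset\mathbb{R}^2$, the farthest-point Voronoi region of $p\in P$ is $\{y\in\mathbb{R}^2 : \lVert y-p\rVert\geq\lVert y-q\rVert\text{ for all }q\in P\setminus\{p\}\}$, and the farthest-point Voronoi diagram of $P$ is the collection of all these regions. The boundary of a region consists of pieces of curves without endpoints, which are loci of points belonging to exactly two farthest-point Voronoi regions, and of their endpoints, which belong to at least three regions. The former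 are called the edges of the diagram, and the latter the vertices of the diagram. Thus every point belonging to exactly two regions lies on an edge, and the vertices are the points belonging to at least three regions. The two defining points of an edge are the two points of $P$ whose regions contain the points of that edge. The defining points of a vertex are the (at least three) points of $P$ whose regions contain that vertex. Shamos--Hoey algorithm. Input: $n\geq 2$ and $P=\{p_1,\ldots,p_n\}\subset\mathbb{R}^2$. (1) Construct the farthest-point Voronoi diagram of $P$. (2) For each edge of the diagram determine the distance between its two defining points, and find the maximum among these distances. (3) If the two-point disk of the corresponding points (a pair of defining points of an edge that realizes this maximum) contains $p_1,\ldots,p_n$, return the center and the radius of this disk and stop. (4) Otherwise, for each vertex of the diagram compute its distance to one of its defining points. Find the minimum among these distances, and return a corresponding vertex (one realizing the minimum) together with the minimum distance. *)

(* Defs.v *)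
From HB Require Import structures.
From mathcomp Require Import all_boot all_order all_algebra.
From mathcomp Require Import finmap.
From mathcomp Require Import all_classical all_reals all_analysis.
Set Implicit Arguments.
Unset Strict Implicit.
Unset Printing Implicit Defensive.
Import Order.TTheory GRing.Theory Num.Theory.
Import numFieldNormedType.Exports.
Local Open Scope classical_set_scope.
Local Open Scope ring_scope.

(* The plane is 'rV[R]_2 and the norm under study is an explicit function N.
   The norm `|_| that the library attaches to 'rV[R]_2 is the sup norm; it is
   used only through the topology of the plane (in connected_component), which
   does not depend on the norm. *)

Section MinimalEnclosingDisk.
Variable R : realType.
Local Notation plane := 'rV[R]_2.

Record is_norm (N : plane -> R) : Prop := IsNorm {
  norm_definite : forall x, N x = 0 -> x = 0;
  norm_homogeneous : forall (a : R) x, N (a *: x) = `|a| * N x;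
  norm_triangle : forall x y, N (x + y) <= N x + N y }.

Definition strictly_convex (N : plane -> R) : Prop :=
  forall x y, N x = 1 -> N y = 1 -> x != y -> N (x + y) < 2.

Variable N : plane -> R.

Definition disk (x : plane) (lambda : R) : set plane :=
  [set y | N (y - x) <= lambda].

(* A disk is represented by the pair of its center and its radius. *)
Definition two_point_disk (pq : plane * plane) : plane * R :=
  (2^-1 *: (pq.1 + pq.2), 2^-1 * N (pq.1 - pq.2)).

Definition encloses (D : plane * R) (P : {fset plane}) : Prop :=
  [set` P] `<=` disk D.1 D.2.

(* For nonempty P the default value 0 of the maximum is harmless, the distances
   being nonnegative. *)
Definition enclosing_radius (P : {fset plane}) : R :=
  inf [set \big[Num.max/0]_(p <- P) N (x - p) | x in [set: plane]].

Definition minimal_enclosing_disk (P : {fset plane}) (D : plane * R) : Prop :=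
  D.2 = enclosing_radius P /\ encloses D P.

Definition fpv_region (P : {fset plane}) (p : plane) : set plane :=
  [set y | forall q, q \in P -> q != p -> N (y - q) <= N (y - p)].

Definition defining_points (P : {fset plane}) (y : plane) : {fset plane} :=
  [fset p in P | `[< fpv_region P p y >]]%fset.

(* The points of exactly two regions, namely those of p and q. *)
Definition edge_locus (P : {fset plane}) (p q : plane) : set plane :=
  [set y | defining_points P y = [fset p; q]%fset].

(* The edges with defining points p and q are the maximal connected pieces of
   their locus; in particular, a pair of points may define several edges
   a priori, or none. *)
Definition fpv_edge (P : {fset plane}) (p q : plane) (E : set plane) : Prop :=
  p != q /\
  exists2 y, edge_locus P p q y & E = connected_component (edge_locus P p q) y.

Definition fpv_vertex (P : {fset plane}) (v : plane) : Prop :=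
  (3 <= #|` defining_points P v|)%N.

(* A possible outcome of the search for the maximal distance between the two
   defining points of an edge. *)
Definition longest_edge_pair (P : {fset plane}) (pq : plane * plane) : Prop :=
  (exists E, fpv_edge P pq.1 pq.2 E) /\
  forall p q E, fpv_edge P p q E -> N (p - q) <= N (pq.1 - pq.2).

(* The distance of a vertex v to one of its defining points is computed; c v is
   the one chosen. *)
Definition vertex_choice (P : {fset plane}) (c : plane -> plane) : Prop :=
  forall v, fpv_vertex P v -> c v \in defining_points P v.

Definition nearest_vertex (P : {fset plane}) (c : plane -> plane)
    (D : plane * R) : Prop :=
  [/\ fpv_vertex P D.1, D.2 = N (D.1 - c D.1)
    & forall v, fpv_vertex P v -> D.2 <= N (v - c v)].

(* D may be returned once pq is selected among the longest edge pairs. *)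
Definition shamos_hoey_returns (P : {fset plane}) (c : plane -> plane)
    (pq : plane * plane) (D : plane * R) : Prop :=
  (encloses (two_point_disk pq) P -> D = two_point_disk pq) /\
  (~ encloses (two_point_disk pq) P -> nearest_vertex P c D).

(* The algorithm leaves some choices open: which longest edge pair to keep,
   which defining point to use for a vertex, which nearest vertex to return.
   Every run, for whatever choices, must reach a result, and every result must satisfy Q. *)
Definition shamos_hoey_computes (P : {fset plane})
    (Q : plane * R -> Prop) : Prop :=
  forall c, vertex_choice P c ->
    (exists pq, longest_edge_pair P pq) /\
    forall pq, longest_edge_pair P pq ->
      (exists D, shamos_hoey_returns P c pq D) /\
      forall D, shamos_hoey_returns P c pq D -> Q D.

End MinimalEnclosingDisk.

(* Main.v *)
Require Import Defs.
From mathcomp Require Import all_boot all_order all_algebra.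
From mathcomp Require Import finmap.
From mathcomp Require Import all_classical all_reals all_analysis.
From mathcomp Require Import ring lra.
Import Order.TTheory GRing.Theory Num.Theory.
Import numFieldNormedType.Exports.
Local Open Scope ring_scope.

(** Let f x be the distance from x to a farthest point of P, and let z minimize
    f, so that f z is the radius R(P) of the minimal enclosing disk. The
    defining points of x are the points of P at distance f x from x, and the
    disk of center x and radius f x always encloses P.

    A two-point disk of two points of P that encloses P is minimal, since any
    disk containing the two points has at least half their distance as radius.
    This settles the case where the algorithm stops early.

    Otherwise z is a vertex. Suppose that z had only one or two defining
    points p and q (possibly p = q). If |p - q| < 2 f z, moving z slightly
    towards the midpoint of p and q would decrease f; so |p - q| >= 2 f z
    (diametral_defining_points). Then p and q differ, they define an edge
    through z, and a longest edge pair is at distance at least 2 f z as well.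
    Both its points are within f z of z, so strict convexity makes z their
    midpoint and their two-point disk encloses P (long_pair_encloses), against
    the assumption. Hence z is a vertex; every vertex v satisfies f v >= f z,
    so the minimum over the vertices exists and equals R(P), and the disk
    around any minimizing vertex encloses P.

    It remains to see that the diagram has an edge at all, i.e. that some point
    has exactly two defining points (exists_edge_point). Travelling from y
    straight to one of its defining points s, one must leave the region of s,
    and a point where this happens has at least two defining points. If all
    these points were vertices, infinitely many choices of y and the finiteness
    of P would give two different vertices with the same defining points. This
    is impossible because a strictly convex planar norm admits at most one
    circle through three given points (circumcenter_unique). *)

(** * Auxiliary facts on Lipschitz functions and finite sets *)

Lemma lipschitz_continuous (R : realType) (V : normedModType R) (f : V -> R)
    (K : R) :
  0 <= K -> (forall x y, `|f x - f y| <= K * `|x - y|) -> continuous f.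
Proof.
move=> K0 fK x; apply/cvgrPdist_le => e e0.
have K1 : 0 < K + 1 by lra.
have eK : 0 < e / (K + 1) by rewrite divr_gt0.
near=> y.
apply: le_trans (fK x y) _.
have : `|x - y| <= e / (K + 1).
  by near: y; apply: (cvgr_dist_le id x _ (e / (K + 1))) => //; exact: cvg_id.
rewrite ler_pdivlMr // mulrDr mulr1 mulrC.
by have := normr_ge0 (x - y); lra.
Unshelve. all: by end_near. Qed.

Lemma three_elements (K : choiceType) (A : {fset K}) : (2 < #|` A|)%N ->
  exists a b c, [/\ a \in A, b \in A & c \in A] /\ [/\ a != b, a != c & b != c].
Proof.
move=> A2; have := fset_uniq A.
have memA x : (x \in A) = (x \in enum_fset A) by [].
move: A2 memA; case: (enum_fset A) => [|a [|b [|c l]]] //= _ memA.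
rewrite !inE !negb_or => /andP[/and3P[ab ac _] /andP[/andP[bc _] _]].
by exists a, b, c; rewrite !memA !inE !eqxx !orbT.
Qed.

Lemma pigeonhole (T : finType) (f : nat -> T) :
  exists k l, k <> l /\ f k = f l.
Proof.
have /injectivePn[k [l /eqP kl fkl]] :
    ~~ injectiveb (fun k : 'I_(#|T|.+1) => f k).
  by apply/negP => /injectiveP /leq_card; rewrite card_ord ltnn.
by exists k, l; split=> // /val_inj.
Qed.

(** * Strictly convex norms on the plane *)

Section PlaneNorm.
Variables (R : realType) (N : 'rV[R]_2 -> R).
Hypothesis N_norm : is_norm N.
Implicit Types u v w x y z p q s : 'rV[R]_2.
Implicit Types (a b t r : R) (P : {fset 'rV[R]_2}).

Lemma norm0 : N 0 = 0.
Proof. by rewrite -(scale0r 0) (norm_homogeneous N_norm) normr0 mul0r. Qed.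

Lemma normN x : N (- x) = N x.
Proof. by rewrite -scaleN1r (norm_homogeneous N_norm) normrN1 mul1r. Qed.

Lemma norm_subC x y : N (x - y) = N (y - x).
Proof. by rewrite -normN opprB. Qed.

Lemma norm_ge0 x : 0 <= N x.
Proof.
have := norm_triangle N_norm x (- x).
by rewrite subrr norm0 normN; lra.
Qed.

Lemma norm_gt0 x : x != 0 -> 0 < N x.
Proof.
move=> x0; rewrite lt_neqAle norm_ge0 andbT eq_sym.
by apply: contra x0 => /eqP /(norm_definite N_norm)->.
Qed.

Lemma norm_scale a x : 0 <= a -> N (a *: x) = a * N x.
Proof. by move=> a0; rewrite (norm_homogeneous N_norm) ger0_norm. Qed.

(** The triangle inequality along the broken line x, y, z. *)
Lemma norm_path x y z : N (x - z) <= N (x - y) + N (y - z).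
Proof. by rewrite -[x - z](subrKA y) (norm_triangle N_norm). Qed.

Lemma norm_lipschitz x y : `|N x - N y| <= N (x - y).
Proof.
have := norm_path x y 0; have := norm_path y x 0.
by rewrite !subr0 (norm_subC y x) ler_norml; lra.
Qed.

Lemma norm_convex t x y : 0 <= t <= 1 ->
  N ((1 - t) *: x + t *: y) <= (1 - t) * N x + t * N y.
Proof.
move=> /andP[t0 t1]; apply: le_trans (norm_triangle N_norm _ _) _.
by rewrite !norm_scale ?subr_ge0.
Qed.

Definition det2 u v : R := u 0 0 * v 0 1 - u 0 1 * v 0 0.

Lemma plane_ext u v : u 0 0 = v 0 0 -> u 0 1 = v 0 1 -> u = v.
Proof.
move=> h0 h1; apply/rowP => i.
case: i => [[|[|//]] hi].
- by rewrite (_ : Ordinal hi = 0) //; apply: val_inj.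
- by rewrite (_ : Ordinal hi = 1) //; apply: val_inj.
Qed.

Lemma det2_eq0 u v : u != 0 -> det2 u v = 0 -> exists b, v = b *: u.
Proof.
rewrite /det2 => u0 duv.
have [u00|u00] := eqVneq (u 0 0) 0.
  have u01 : u 0 1 != 0.
    by apply: contra u0 => /eqP u01; apply/eqP/plane_ext; rewrite mxE.
  exists (v 0 1 / u 0 1).
  have v0 : v 0 0 = 0.
    by apply: (mulfI u01); rewrite mulr0; move: duv; rewrite u00; lra.
  by apply: plane_ext; rewrite !mxE ?u00 ?v0 ?mulr0 // divfK.
exists (v 0 0 / u 0 0); apply: plane_ext; rewrite !mxE ?divfK //.
apply: (mulfI u00).
have -> : u 0 0 * v 0 1 = u 0 1 * v 0 0 by lra.
by field.
Qed.

Hypothesis N_convex : strictly_convex N.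

(** After normalizing x and y, strict convexity bounds the sum of the two unit
    vectors strictly; the excess of the longer vector is a multiple of its own
    direction and contributes its full length. *)
Lemma strict_triangle x y : det2 x y != 0 -> N (x + y) < N x + N y.
Proof.
wlog le_xy : x y / N x <= N y.
  move=> H dxy; have [/H->//|/ltW yx] := leP (N x) (N y).
  rewrite addrC [N x + _]addrC H //.
  by apply: contra dxy => /eqP d0; apply/eqP; move: d0; rewrite /det2; lra.
move=> dxy.
have x0 : x != 0.
  by apply: contra dxy => /eqP->; apply/eqP; rewrite /det2 !mxE; ring.
have y0 : y != 0.
  by apply: contra dxy => /eqP->; apply/eqP; rewrite /det2 !mxE; ring.
have Nx := norm_gt0 x x0; have Ny := norm_gt0 y y0.
set a := (N x)^-1 *: x; set b := (N y)^-1 *: y.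
have Na : N a = 1 by rewrite norm_scale ?invr_ge0 ?ltW // mulVf ?gt_eqF.
have Nb : N b = 1 by rewrite norm_scale ?invr_ge0 ?ltW // mulVf ?gt_eqF.
have ab : a != b.
  apply: contra dxy => /eqP ab.
  have -> : x = (N x / N y) *: y.
    by rewrite -scalerA -/b -ab /a scalerA mulfV ?scale1r // gt_eqF.
  by apply/eqP; rewrite /det2 !mxE; ring.
have Nab := N_convex a b Na Nb ab.
have -> : x + y = N x *: (a + b) + (N y - N x) *: b.
  by apply: plane_ext; rewrite !mxE; field; rewrite !gt_eqF.
apply: le_lt_trans (norm_triangle N_norm _ _) _.
rewrite (norm_scale (N x)) ?ltW // (norm_scale (N y - N x)) ?subr_ge0 // Nb.
have : N x * N (a + b) < N x * 2 by rewrite ltr_pM2l.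
lra.
Qed.

(** The equality case of the triangle inequality in a ball: it forces both norms
    to be r, and two different vectors of norm r have a sum shorter than
    2 r. *)
Lemma norm_add_eq r x y : 0 < r ->
  N x <= r -> N y <= r -> 2 * r <= N (x + y) -> x = y.
Proof.
move=> r0 xr yr xyr; have txy := norm_triangle N_norm x y.
have Nx : N x = r by lra.
have Ny : N y = r by lra.
apply/eqP; apply: contraLR xyr => xy; rewrite -ltNge.
have Ns z : N z = r -> N (r^-1 *: z) = 1.
  by move=> Nz; rewrite norm_scale ?invr_ge0 ?ltW // Nz mulVf ?gt_eqF.
have /(N_convex _ _ (Ns x Nx) (Ns y Ny)) : r^-1 *: x != r^-1 *: y.
  by apply: contra xy => /eqP /scalerI->//; rewrite invr_eq0 gt_eqF.
rewrite -scalerDr norm_scale ?invr_ge0 ?ltW //.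
by rewrite ltr_pdivrMl // mulrC.
Qed.

(** * Two circles meet at most once on each side of the line of centers *)

(** The sign conditions mean that the segments from 0 to P and from v to Q
    cross. The diagonals of a quadrilateral are together longer than two
    opposite sides: apply the triangle inequality to both sides through the
    crossing point c. *)
Lemma crossing_segments (v P Q : 'rV[R]_2) b t :
  det2 v P != 0 -> 0 <= t <= 1 -> b < 0 ->
  Q = b *: v + t *: P -> N Q + N (P - v) < N P + N (Q - v).
Proof.
move=> dvP /andP[t0 t1] b0 QE.
have e0 : 0 < 1 - b by lra.
(* s and s * t are the positions of the crossing point c on the segments
   from v to Q and from 0 to P. *)
pose s := (1 - b)^-1.
have s0 : 0 < s by rewrite invr_gt0.
have s1 : s < 1 by rewrite invf_lt1 //; lra.
have sb : s * b = s - 1 by rewrite /s; field; rewrite gt_eqF.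
have st1 : s * t < 1 by apply: le_lt_trans s1; rewrite ler_piMr // ltW.
have st0 : 0 <= s * t by rewrite mulr_ge0 // ltW.
pose c := (s * t) *: P.
have NP : N c + N (P - c) = N P.
  have -> : P - c = (1 - s * t) *: P by rewrite scalerBl scale1r.
  by rewrite /c !norm_scale //; lra.
have cE : c = (1 - s) *: v + s *: Q.
  rewrite QE scalerDr !scalerA sb addrA -scalerDl.
  have -> : 1 - s + (s - 1) = 0 by ring.
  by rewrite scale0r add0r.
have NQ : N (Q - c) + N (c - v) = N (Q - v).
  have -> : Q - c = (1 - s) *: (Q - v).
    by rewrite cE; apply: plane_ext; rewrite !mxE; ring.
  have -> : c - v = s *: (Q - v).
    by rewrite cE; apply: plane_ext; rewrite !mxE; ring.
  rewrite !norm_scale ?(ltW s0) //; last lra.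
  ring.
have NPv : N (P - v) < N (P - c) + N (c - v).
  rewrite -[P - v](subrKA c); apply: strict_triangle.
  have -> : det2 (P - c) (c - v) = (1 - s * t) * det2 v P.
    by rewrite /det2 !mxE; ring.
  by rewrite mulf_neq0 // gt_eqF // subr_gt0.
have NQ' := norm_path Q c 0.
by move: NQ'; rewrite !subr0; lra.
Qed.

(** Here Q lies in the triangle 0, v, P. Moving P inside the triangle to
    another point decreases the sum of the distances to 0 and v, so both
    distances can be kept only at P itself. *)
Lemma triangle_inside (v P Q : 'rV[R]_2) b t :
  det2 v P != 0 -> 0 <= b -> 0 <= t -> b + t <= 1 -> Q = b *: v + t *: P ->
  N Q = N P -> N (Q - v) = N (P - v) -> Q = P.
Proof.
move=> dvP b0 t0 bt QE NQ NQv.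
have vP : N v < N P + N (P - v).
  rewrite (norm_subC P) -[X in N X < _](subrKC P) //.
  apply: strict_triangle.
  suff -> : det2 P (v - P) = - det2 v P by rewrite oppr_eq0.
  by rewrite /det2 !mxE; ring.
have [t1|t1] := eqVneq t 1.
  have b00 : b = 0 by lra.
  by rewrite QE t1 b00 scale0r add0r scale1r.
have tl1 : t < 1 by rewrite lt_neqAle t1 /=; lra.
have h1 : N Q <= b * N v + t * N P.
  rewrite QE; apply: le_trans (norm_triangle N_norm _ _) _.
  by rewrite !norm_scale.
have h2 : N (Q - v) <= (1 - b - t) * N v + t * N (P - v).
  have -> : Q - v = (1 - b - t) *: (- v) + t *: (P - v).
    by rewrite QE; apply: plane_ext; rewrite !mxE; ring.
  apply: le_trans (norm_triangle N_norm _ _) _.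
  by rewrite !norm_scale ?normN //; lra.
have : (1 - t) * N v < (1 - t) * (N P + N (P - v)).
  by rewrite ltr_pM2l // subr_gt0.
by move=> h3; exfalso; lra.
Qed.

(** Take z1 as origin, z2 as v, and P at least as far from the line of centers
    as Q. Either Q lies in the triangle of the centers and P, or a segment from
    one center to P crosses the segment from the other center to Q; both are
    excluded by comparing sums of distances to the centers. *)
Lemma circles_meet_once_per_side z1 z2 p q : z1 != z2 ->
  0 <= det2 (z2 - z1) (p - z1) -> 0 <= det2 (z2 - z1) (q - z1) ->
  N (p - z1) = N (q - z1) -> N (p - z2) = N (q - z2) -> p = q.
Proof.
move=> z12.
wlog le_pq : p q / det2 (z2 - z1) (q - z1) <= det2 (z2 - z1) (p - z1).
  move=> H dp dq h1 h2.
  have [/H->//|/ltW /H <- //] :=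
    leP (det2 (z2 - z1) (q - z1)) (det2 (z2 - z1) (p - z1)).
set v := z2 - z1; move=> dp dq h1 h2.
have v0 : v != 0 by rewrite subr_eq0 eq_sym.
apply: (addIr (- z1)).
have subv x : x - z2 = (x - z1) - v by rewrite /v opprB addrA addrNK.
move: h2; rewrite !subv; move: dp dq h1 le_pq; rewrite -/v.
move: (p - z1) (q - z1) => P Q dP dQ hPQ dQP hPQv.
(* Both points on the line of centers: each is determined by its distances
   to the two centers. *)
have [dP0|dP0] := eqVneq (det2 v P) 0.
  have dQ0 : det2 v Q = 0 by apply/eqP; rewrite eq_le dQ -dP0 dQP.
  have [a aP] := det2_eq0 v P v0 dP0; have [b bQ] := det2_eq0 v Q v0 dQ0.
  have Nv := norm_gt0 v v0.
  move: hPQ hPQv; rewrite aP bQ.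
  have sv c : c *: v - v = (c - 1) *: v by rewrite scalerBl scale1r.
  rewrite !sv !(norm_homogeneous N_norm) => /(mulIf (lt0r_neq0 Nv)) e1.
  move=> /(mulIf (lt0r_neq0 Nv)) e2; congr (_ *: _).
  have : `|a| ^+ 2 = `|b| ^+ 2 by rewrite e1.
  have : `|a - 1| ^+ 2 = `|b - 1| ^+ 2 by rewrite e2.
  by rewrite !real_normK ?num_real //; lra.
have dPp : 0 < det2 v P by rewrite lt_neqAle eq_sym dP0.
pose t := det2 v Q / det2 v P.
have t0 : 0 <= t by rewrite divr_ge0.
have t1 : t <= 1 by rewrite ler_pdivrMr // mul1r.
have [b bE] : exists b, Q - t *: P = b *: v.
  apply: det2_eq0 => //.
  have -> : det2 v (Q - t *: P) = det2 v Q - t * det2 v P.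
    by rewrite /det2 !mxE; ring.
  by rewrite divfK // subrr.
have QE : Q = b *: v + t *: P by rewrite -bE subrK.
have [b0|b0] := ltP b 0.
  exfalso; have := crossing_segments v P Q b t dP0 _ b0 QE.
  by rewrite t0 t1 => /(_ isT); lra.
have [bt|bt] := leP (b + t) 1.
  by apply/esym/(triangle_inside v P Q b t).
(* The remaining case is the crossing seen from z2 instead of z1. *)
have dvP' : det2 (- v) (P - v) != 0.
  suff -> : det2 (- v) (P - v) = - det2 v P by rewrite oppr_eq0.
  by rewrite /det2 !mxE; ring.
have QE' : Q - v = (1 - b - t) *: (- v) + t *: (P - v).
  by rewrite QE; apply: plane_ext; rewrite !mxE; ring.
have bt' : 1 - b - t < 0 by lra.
exfalso; have := crossing_segments _ _ _ _ t dvP' _ bt' QE'.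
by rewrite !opprK !subrK t0 t1 => /(_ isT); lra.
Qed.

(** Of three points, two lie on the same closed side of the line through the
    centers; the two circles would meet twice on that side. *)
Lemma circumcenter_unique z1 z2 p q s : p != q -> p != s -> q != s ->
  N (p - z1) = N (q - z1) -> N (p - z1) = N (s - z1) ->
  N (p - z2) = N (q - z2) -> N (p - z2) = N (s - z2) -> z1 = z2.
Proof.
move=> pq ps qs pq1 ps1 pq2 ps2; apply/eqP; apply: contraT => z12.
have z21 : z2 != z1 by rewrite eq_sym.
have swap x : det2 (z1 - z2) (x - z2) = - det2 (z2 - z1) (x - z1).
  by rewrite /det2 !mxE; ring.
have side x y : x != y -> N (x - z1) = N (y - z1) -> N (x - z2) = N (y - z2) ->
    0 <= det2 (z2 - z1) (x - z1) -> det2 (z2 - z1) (y - z1) < 0.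
  move=> xy h1 h2 dx; rewrite ltNge; apply/negP => dy.
  by move/eqP: xy; apply; apply: (circles_meet_once_per_side z1 z2).
have side' x y : x != y -> N (x - z1) = N (y - z1) -> N (x - z2) = N (y - z2) ->
    det2 (z2 - z1) (x - z1) <= 0 -> 0 < det2 (z2 - z1) (y - z1).
  move=> xy h1 h2 dx; rewrite ltNge; apply/negP => dy.
  move/eqP: xy; apply; apply: (circles_meet_once_per_side z2 z1) => //;
    by rewrite swap oppr_ge0.
have qs1 : N (q - z1) = N (s - z1) by rewrite -pq1.
have qs2 : N (q - z2) = N (s - z2) by rewrite -pq2.
have [dp|/ltW dp] := leP 0 (det2 (z2 - z1) (p - z1)).
  have := side p q pq pq1 pq2 dp; have := side p s ps ps1 ps2 dp.
  by move=> ds /ltW /(side' q s qs qs1 qs2); rewrite ltNge ltW.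
have := side' p q pq pq1 pq2 dp; have := side' p s ps ps1 ps2 dp.
by move=> ds /ltW /(side q s qs qs1 qs2); rewrite ltNge ltW.
Qed.

(** * Comparison with the sup norm *)

Lemma norm_le_sup_norm : exists2 C : R, 0 <= C & forall x, N x <= C * `|x|.
Proof.
exists (N (delta_mx 0 0) + N (delta_mx 0 1)).
  by rewrite addr_ge0 // norm_ge0.
move=> x.
have entry i : `|x 0 i| <= `|x|.
  rewrite [leRHS]/Num.norm /= mx_normrE.
  exact: (le_bigmax _ (fun ij : 'I_1 * 'I_2 => `|x ij.1 ij.2|) (0, i)).
have xE : x = x 0 0 *: delta_mx 0 0 + x 0 1 *: delta_mx 0 1.
  by apply: plane_ext; rewrite !mxE /=; ring.
rewrite [in leLHS]xE; apply: le_trans (norm_triangle N_norm _ _) _.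
rewrite !(norm_homogeneous N_norm).
have := ler_wpM2r (norm_ge0 (delta_mx 0 0)) (entry 0).
have := ler_wpM2r (norm_ge0 (delta_mx 0 1)) (entry 1).
lra.
Qed.

Lemma lipschitz_plane_continuous (f : 'rV[R]_2 -> R) :
  (forall x y, `|f x - f y| <= N (x - y)) -> continuous f.
Proof.
move=> fN; have [C C0 NC] := norm_le_sup_norm.
by apply: (@lipschitz_continuous _ _ f C C0) => x y; apply: le_trans (fN x y) _.
Qed.

(** N attains a positive minimum on the compact unit sphere of the sup norm. *)
Lemma sup_norm_le_norm : exists2 m : R, 0 < m & forall x, m * `|x| <= N x.
Proof.
pose S : set 'rV[R]_2 := [set x | `|x| = 1]%classic.
have S1 : S (const_mx 1).
  rewrite /S /= /Num.norm /= mx_normrE.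
  apply/eqP; rewrite eq_le; apply/andP; split.
    by apply: bigmax_le => // -[i j] _; rewrite mxE normr1.
  by rewrite (le_trans _ (le_bigmax _ _ (0, 0))) //= mxE normr1.
have Scompact : compact S.
  apply: bounded_closed_compact.
    exists 1; split; first exact: num_real.
    by move=> M M1 x /= ->; rewrite ltW.
  have -> : S = ((fun x : 'rV[R]_2 => `|x|) @^-1` [set 1])%classic by [].
  apply: preimage_closed; last exact: closed_eq.
  by move=> x _; exact: norm_continuous.
have [||c Sc cmin] := @EVT_min_rV _ _ N S _ Scompact.
- by exists (const_mx 1).
- apply: continuous_subspaceT; apply: lipschitz_plane_continuous => x y.
  exact: norm_lipschitz.
have c0 : c != 0.
  move: Sc; rewrite inE /S /= => c1.
  by rewrite -normr_gt0 c1.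
exists (N c); first exact: norm_gt0.
move=> x; have [->|x0] := eqVneq x 0; first by rewrite normr0 mulr0 norm0.
have xp : 0 < `|x| by rewrite normr_gt0.
have : N c <= N (`|x|^-1 *: x).
  by apply: cmin; rewrite inE /S /= normfZV.
rewrite norm_scale ?invr_ge0 // => h.
by rewrite mulrC -ler_pdivlMl.
Qed.

(** * The farthest distance and its minimum *)

Definition farthest_distance P x : R := \big[Num.max/0]_(p <- P) N (x - p).

Lemma le_farthest P x p : p \in P -> N (x - p) <= farthest_distance P x.
Proof.
by move=> pP; apply: (le_bigmax_seq 0 p xpredT (fun p => N (x - p))).
Qed.

Lemma farthest_le P x r : 0 <= r -> (forall p, p \in P -> N (x - p) <= r) ->
  farthest_distance P x <= r.
Proof.
by move=> r0 h; rewrite /farthest_distance big_seq; apply: bigmax_le.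
Qed.

Lemma farthest_lt P x r : 0 < r -> (forall p, p \in P -> N (x - p) < r) ->
  farthest_distance P x < r.
Proof.
by move=> r0 h; rewrite /farthest_distance big_seq; apply: bigmax_lt.
Qed.

Lemma farthest_ge0 P x : 0 <= farthest_distance P x.
Proof.
rewrite /farthest_distance; elim/big_rec: _ => // p a _ a0.
by rewrite le_max a0 orbT.
Qed.

Lemma farthest_attained P x : P != fset0 ->
  exists2 p, p \in P & N (x - p) = farthest_distance P x.
Proof.
case/fset0Pn => p0 p0P; apply: contrapT => none.
have lt_f p : p \in P -> N (x - p) < farthest_distance P x.
  move=> pP; rewrite lt_neqAle le_farthest // andbT.
  by apply/eqP => e; apply: none; exists p.
suff : farthest_distance P x < farthest_distance P x by rewrite ltxx.
by apply: farthest_lt => //; apply: le_lt_trans (norm_ge0 _) (lt_f _ p0P).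
Qed.

Lemma farthest_lipschitz P x y :
  `|farthest_distance P x - farthest_distance P y| <= N (x - y).
Proof.
have half u v : farthest_distance P u <= farthest_distance P v + N (u - v).
  apply: farthest_le; first by rewrite addr_ge0 ?farthest_ge0 ?norm_ge0.
  move=> p pP; apply: le_trans (norm_path _ v _) _.
  by rewrite addrC lerD2r le_farthest.
have := half x y; have := half y x.
by rewrite (norm_subC y) ler_norml; lra.
Qed.

Lemma mem_defining_points P x p : p \in defining_points N P x <->
  p \in P /\ N (x - p) = farthest_distance P x.
Proof.
rewrite !inE /=; split=> [/andP[pP /asboolP far]|[pP far]].
  split=> //; apply/eqP; rewrite eq_le le_farthest //=.
  apply: farthest_le; first exact: norm_ge0.
  by move=> q qP; have [->//|qp] := eqVneq q p; apply: far.
rewrite pP /=; apply/asboolP => q qP _.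
by rewrite far le_farthest.
Qed.

(** Outside a large ball the farthest distance exceeds its value at 0, and on
    the ball it attains its minimum by compactness. *)
Lemma farthest_distance_min P : P != fset0 ->
  exists z, forall x, farthest_distance P z <= farthest_distance P x.
Proof.
case/fset0Pn => p pP; have [m m0 mN] := sup_norm_le_norm.
set f := farthest_distance P.
pose rho := (f 0 + N p) / m.
have rho0 : 0 <= rho.
  apply: divr_ge0; last exact: ltW.
  by rewrite addr_ge0 ?farthest_ge0 ?norm_ge0.
pose B : set 'rV[R]_2 := [set x | `|x| <= rho]%classic.
have Bcompact : compact B.
  apply: bounded_closed_compact.
    exists rho; split; first exact: num_real.
    by move=> M M1 x /= xr; rewrite (le_trans xr) ?ltW.
  have -> : B = ((fun x : 'rV[R]_2 => `|x|) @^-1`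
                 [set r | r <= rho])%classic by [].
  apply: preimage_closed; last exact: closed_le.
  by move=> x _; exact: norm_continuous.
have B0 : B 0 by rewrite /B /= normr0.
have [||z Bz zmin] := @EVT_min_rV _ _ f B _ Bcompact.
- by exists 0.
- apply: continuous_subspaceT; apply: lipschitz_plane_continuous => x y.
  exact: farthest_lipschitz.
exists z => x; have [xr|xr] := leP `|x| rho; first by apply: zmin; rewrite inE.
apply: le_trans (zmin 0 _) _; first by rewrite inE.
have : f 0 + N p <= m * `|x|.
  by rewrite mulrC -ler_pdivrMr // ltW.
have := mN x; have := le_farthest P x p pP; rewrite -/f.
have := norm_path x p 0; rewrite !subr0.
by lra.
Qed.

Lemma enclosing_radius_min P z :
  (forall x, farthest_distance P z <= farthest_distance P x) ->
  enclosing_radius N P = farthest_distance P z.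
Proof.
move=> zmin; rewrite /enclosing_radius; set A := (X in inf X).
have lbA : lbound A (farthest_distance P z).
  by move=> _ [x _ <-]; exact: zmin.
have Az : A (farthest_distance P z) by exists z.
apply/eqP; rewrite eq_le; apply/andP; split.
  by apply: ge_inf => //; exists (farthest_distance P z).
by apply: lb_le_inf => //; exists (farthest_distance P z).
Qed.

Lemma encloses_farthest P z r : farthest_distance P z <= r ->
  encloses N (z, r) P.
Proof.
move=> fr p /= pP; rewrite /disk /= norm_subC.
exact: le_trans (le_farthest _ _ _ pP) fr.
Qed.

(** * Defining points of the optimal center *)

(** Along the segment from z to x the distance to p is convex. It starts at most
    r; if it starts at r it ends below r, so it drops at once, and if it starts
    below r it remains so for a while. The bound e works for all the finitely
    many p. *)
Lemma segment_enters_disk (l : seq 'rV[R]_2) z x r :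
  (forall p, p \in l -> N (z - p) <= r /\ (N (z - p) = r -> N (x - p) < r)) ->
  exists2 e, 0 < e <= 1 & forall t, 0 < t <= e ->
    forall p, p \in l -> N ((1 - t) *: z + t *: x - p) < r.
Proof.
elim: l => [|p l IH] hl; first by exists 1; rewrite ?ltr01 ?lexx.
have [|e /andP[e0 e1] eP] := IH.
  by move=> q ql; apply: hl; rewrite inE ql orbT.
have [zp zx] : N (z - p) <= r /\ (N (z - p) = r -> N (x - p) < r).
  by apply: hl; rewrite mem_head.
have conv t : 0 <= t <= 1 -> N ((1 - t) *: z + t *: x - p) <=
    (1 - t) * N (z - p) + t * N (x - p).
  move=> t01; apply: le_trans (norm_convex t (z - p) (x - p) t01).
  have -> // : (1 - t) *: z + t *: x - p = (1 - t) *: (z - p) + t *: (x - p).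
  by apply: plane_ext; rewrite !mxE; ring.
suff [d /andP[d0 d1] dP] : exists2 d, 0 < d <= 1 & forall t, 0 < t <= d ->
    (1 - t) * N (z - p) + t * N (x - p) < r.
  exists (Num.min d e); first by rewrite lt_min d0 e0 ge_min d1.
  move=> t /andP[t0]; rewrite le_min => /andP[td te] q.
  rewrite inE => /orP[/eqP->|ql]; last by apply: eP; rewrite // t0.
  apply: le_lt_trans (conv t _) (dP t _); last by rewrite t0.
  by rewrite ltW //= (le_trans td).
have [zpr|zpr] := eqVneq (N (z - p)) r.
  exists 1; first by rewrite ltr01 lexx.
  move=> t /andP[t0 t1].
  have : t * N (x - p) < t * r by rewrite ltr_pM2l // zx.
  by rewrite zpr; lra.
have zpl : 0 < r - N (z - p) by rewrite subr_gt0 lt_neqAle zpr.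
have x0 := norm_ge0 (x - p); have z0 := norm_ge0 (z - p).
have x1 : 0 < N (x - p) + 1 by lra.
exists (Num.min 1 ((r - N (z - p)) / (N (x - p) + 1))).
  by rewrite lt_min ltr01 divr_gt0 // ge_min lexx.
move=> t /andP[t0]; rewrite le_min ler_pdivlMr // => /andP[t1 td].
have : 0 <= t * N (z - p) by rewrite mulr_ge0 // ltW.
lra.
Qed.

(** If p and q were closer, their midpoint would have distance less than the
    optimal radius to every defining point of z, and moving z towards it would
    give a smaller enclosing disk. The case p = q covers a single defining
    point. *)
Lemma diametral_defining_points P z p q :
  (forall x, farthest_distance P z <= farthest_distance P x) ->
  (forall s, s \in defining_points N P z -> s = p \/ s = q) ->
  2 * farthest_distance P z <= N (p - q).
Proof.
move=> zmin Dz; rewrite leNgt; apply/negP => pq.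
set r := farthest_distance P z in zmin pq.
have r0 : 0 < r by have := norm_ge0 (p - q); lra.
pose x := 2^-1 *: (p + q).
have half : 2^-1 * N (p - q) < r by lra.
have [|e /andP[e0 e1] eP] := segment_enters_disk P z x r.
  move=> s sP; split=> [|zs]; first exact: le_farthest.
  have [|->|->] := Dz s; first by apply/mem_defining_points.
    have -> : x - p = 2^-1 *: (q - p).
      by apply: plane_ext; rewrite !mxE; field.
    by rewrite norm_scale ?invr_ge0 // norm_subC.
  have -> : x - q = 2^-1 *: (p - q).
    by apply: plane_ext; rewrite !mxE; field.
  by rewrite norm_scale ?invr_ge0.
have := zmin ((1 - e) *: z + e *: x); apply/negP; rewrite -ltNge.
by apply: farthest_lt => //; apply: eP; rewrite e0 lexx.
Qed.

(** * Existence of an edge *)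

(** On the way from y to s, the point s is a farthest point of P at the start,
    but not at the end. By the intermediate value theorem the distance to s
    equals at some moment the farthest distance to the other points. *)
Lemma bisecting_point P y s q : s \in defining_points N P y -> q \in P ->
  q != s -> exists2 t, 0 <= t < 1 & let x := y + t *: (s - y) in
    s \in defining_points N P x /\
    exists2 q', q' != s & q' \in defining_points N P x.
Proof.
move=> /mem_defining_points[sP ys] qP qs.
pose x t := y + t *: (s - y).
pose h t := farthest_distance (P `\ s)%fset (x t) - N (x t - s).
have hcont : continuous h.
  apply: (@lipschitz_continuous R R h (2 * N (s - y))).
    by rewrite mulr_ge0 // norm_ge0.
  move=> a b.
  have xab : N (x a - x b) = N (s - y) * `|a - b|.
    rewrite mulrC -(norm_homogeneous N_norm); congr N.
    by apply: plane_ext; rewrite !mxE; ring.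
  have := farthest_lipschitz (P `\ s)%fset (x a) (x b).
  have := norm_lipschitz (x a - s) (x b - s).
  have -> : x a - s - (x b - s) = x a - x b.
    by apply: plane_ext; rewrite !mxE; ring.
  rewrite xab /h !ler_norml => /andP[? ?] /andP[? ?].
  by apply/andP; split; lra.
have h0 : h 0 <= 0.
  rewrite /h /x scale0r addr0 subr_le0; apply: farthest_le.
    exact: norm_ge0.
  by move=> p; rewrite in_fsetD1 ys => /andP[_ pP]; exact: le_farthest.
have h1 : 0 <= h 1.
  by rewrite /h /x scale1r subrKC subrr norm0 subr0 farthest_ge0.
have [||t t01 ht] := @IVT R h 0 1 0 ler01.
- exact: continuous_subspaceT.
- by rewrite ge_min h0 le_max h1 orbT.
have xs : N (x t - s) = farthest_distance (P `\ s)%fset (x t).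
  by move: ht; rewrite /h; lra.
have xsP : N (x t - s) = farthest_distance P (x t).
  apply/eqP; rewrite eq_le le_farthest //= farthest_le ?norm_ge0 //.
  move=> p pP; have [->//|ps] := eqVneq p s.
  by rewrite xs le_farthest // in_fsetD1 ps.
have [|q' q'P xq'] := farthest_attained (P `\ s)%fset (x t).
  by apply/fset0Pn; exists q; rewrite in_fsetD1 qs.
move: q'P; rewrite in_fsetD1 => /andP[q's q'P].
exists t.
  move: t01; rewrite in_itv /= => /andP[-> t1] /=.
  rewrite lt_neqAle t1 andbT; apply: contra q's => /eqP t1E.
  move: xq'; rewrite -xs t1E /x scale1r subrKC subrr norm0.
  by move=> /(norm_definite N_norm) /eqP; rewrite subr_eq0 eq_sym.
split; first by apply/mem_defining_points.
exists q' => //; apply/mem_defining_points; split=> //.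
by rewrite xq' -xs.
Qed.

Lemma vertex_unique P x y : (2 < #|` defining_points N P x|)%N ->
  {subset defining_points N P x <= defining_points N P y} -> x = y.
Proof.
move=> /three_elements[a [b [c [[Da Db Dc] [ab ac bc]]]]] Dxy.
have dist p : p \in defining_points N P x ->
    N (p - x) = farthest_distance P x /\ N (p - y) = farthest_distance P y.
  move=> Dp; have /mem_defining_points[_ px] := Dp.
  by have /mem_defining_points[_ py] := Dxy p Dp; rewrite !(norm_subC p).
have [xa ya] := dist a Da; have [xb yb] := dist b Db; have [xc yc] := dist c Dc.
apply: (circumcenter_unique x y a b c) => //.
- by rewrite xa xb.
- by rewrite xa xc.
- by rewrite ya yb.
- by rewrite ya yc.
Qed.

(** Points y k of a line above s: the segments joining them to s meet only in s,
    which is excluded by t < 1. *)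
Lemma segments_to_apex_disjoint (k l M t t' : R) s : s 0 1 < M -> t < 1 ->
  let y (a : R) : 'rV[R]_2 := \row_i (if i == 0 then a else M) in
  y k + t *: (s - y k) = y l + t' *: (s - y l) -> k = l.
Proof.
move=> sM t1 y e.
have := congr1 (fun u : 'rV[R]_2 => u 0 1) e.
have := congr1 (fun u : 'rV[R]_2 => u 0 0) e.
rewrite !mxE /= => e0 e1.
have tt' : t = t'.
  have d0 : M - s 0 1 != 0 by rewrite gt_eqF // subr_gt0.
  by apply: (mulIf d0); lra.
have d1 : 1 - t != 0 by rewrite gt_eqF // subr_gt0.
by apply: (mulfI d1); move: e0; rewrite -tt'; lra.
Qed.

(** Start from infinitely many points y k of a line that avoids P, and follow
    the segment from y k to one of its farthest points s k up to a point x k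
    with at least two defining points. If every x k had three, the pigeonhole
    principle would give k and l, k <> l, with the same s and the same defining
    points; then x k = x l by uniqueness of the circumcenter, although the two
    segments meet only in s, which is not a defining point of itself. *)
Lemma exists_edge_point P : (1 < #|` P|)%N ->
  exists x p q, p != q /\ defining_points N P x = [fset p; q]%fset.
Proof.
move=> P2; apply: contrapT => none.
have P0 : P != fset0 by rewrite -cardfs_gt0 ltnW.
have second s : exists2 q, q \in P & q != s.
  have : (P `\ s)%fset != fset0.
    rewrite -cardfs_gt0; move: P2; rewrite (cardfsD1 s P).
    by case: (s \in P); case: #|` (P `\ s)%fset|.
  case/fset0Pn => q; rewrite in_fsetD1 => /andP[qs qP].
  by exists q.
(* The horizontal line at height M runs above P. *)
pose M := 1 + \sum_(p <- P) `|p 0 1|.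
have M_above p : p \in P -> p 0 1 < M.
  move=> pP; apply: le_lt_trans (ler_norm _) _.
  have pP' : p \in enum_fset P by [].
  rewrite /M (big_rem p pP') /= ltr_pwDl // lerDl.
  exact: sumr_ge0.
pose y (k : nat) : 'rV[R]_2 := \row_i (if i == 0 then k%:R else M).
pose x k (g : R * P) := y k + g.1 *: (val g.2 - y k).
(* g k consists of the parameter of x k on its segment and of s k. *)
have /choice[g gP] : forall k, exists g : R * P,
    g.1 < 1 /\ (2 < #|` defining_points N P (x k g)|)%N.
  move=> k; have [s sP ys] := farthest_attained P (y k) P0.
  have [q qP qs] := second s.
  have [|t /andP[_ t1] [xs [q' q's xq']]] :=
    bisecting_point P (y k) s q _ qP qs.
    by apply/mem_defining_points.
  exists (t, [` sP]%fset); split=> //=.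
  rewrite /x /=; set D := defining_points _ _ _ in xs xq' *.
  have sub : ([fset s; q'] `<=` D)%fset.
    by apply/fsubsetP => p; rewrite in_fset2 => /orP[]/eqP->.
  have card2 : #|` [fset s; q']%fset| = 2%N by rewrite cardfs2 eq_sym q's.
  rewrite ltnNge; apply/negP => D2; apply: none.
  exists (y k + t *: (s - y k)), s, q'; split; first by rewrite eq_sym.
  by apply/esym/eqP; rewrite eqEfcard sub card2.
have [k [l [kl]]] := pigeonhole (P * {set P})%type (fun k => ((g k).2,
  [set p : P | val p \in defining_points N P (x k (g k))])).
move=> /pair_equal_spec[gkl Dkl].
have [t1 xk] := gP k.
have : x k (g k) = x l (g l).
  apply: (vertex_unique P _ _ xk) => p Dp.
  have /mem_defining_points[pP _] := Dp.
  have : [` pP]%fset \in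
      [set p : P | val p \in defining_points N P (x k (g k))] by rewrite inE.
  by rewrite Dkl inE.
rewrite /x -gkl => xkl.
have := segments_to_apex_disjoint _ _ _ _ _ _ (M_above _ (valP (g k).2)) t1 xkl.
by move=> /eqP; rewrite eqr_nat => /eqP.
Qed.

(** * Correctness of the two outcomes *)

Lemma exists_longest_edge_pair P : (1 < #|` P|)%N ->
  exists pq, longest_edge_pair N P pq.
Proof.
move=> /exists_edge_point[x [p [q [pq Dx]]]].
have defP s : s \in defining_points N P x -> s \in P.
  by move=> /mem_defining_points[].
have pP : p \in P by apply: defP; rewrite Dx in_fset2 eqxx.
have qP : q \in P by apply: defP; rewrite Dx in_fset2 eqxx orbT.
pose is_edge (ab : P * P) :=
  `[< exists E, fpv_edge N P (val ab.1) (val ab.2) E >].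
have pq_edge : is_edge ([` pP]%fset, [` qP]%fset).
  apply/asboolP; exists (connected_component (edge_locus N P p q) x).
  by split=> //; exists x.
case: (arg_maxP (fun ab : P * P => N (val ab.1 - val ab.2)) pq_edge).
move=> ab /asboolP ab_edge ab_max; exists (val ab.1, val ab.2); split=> //.
move=> a b F abF.
have [_ [z Dz _]] := abF.
have defz s : s \in [fset a; b]%fset -> s \in P.
  by rewrite -Dz => /mem_defining_points[].
have aP : a \in P by apply: defz; rewrite in_fset2 eqxx.
have bP : b \in P by apply: defz; rewrite in_fset2 eqxx orbT.
by apply: (ab_max ([` aP]%fset, [` bP]%fset)); apply/asboolP; exists F.
Qed.

Lemma minimal_two_point_disk P pq z :
  (forall x, farthest_distance P z <= farthest_distance P x) ->
  pq.1 \in P -> pq.2 \in P -> encloses N (two_point_disk N pq) P ->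
  minimal_enclosing_disk N P (two_point_disk N pq).
Proof.
move=> zmin pP qP enc; split=> //.
rewrite (enclosing_radius_min P z zmin); apply/eqP; rewrite eq_le; apply/andP.
split.
  have := norm_path pq.1 z pq.2; rewrite (norm_subC pq.1 z) /=.
  have := le_farthest P z _ pP; have := le_farthest P z _ qP.
  lra.
apply: le_trans (zmin (two_point_disk N pq).1) _; apply: farthest_le.
  by rewrite /= mulr_ge0 ?invr_ge0 ?norm_ge0.
by move=> s sP; rewrite norm_subC; exact: enc.
Qed.

(** Both p and q are within the optimal radius of z, so equality holds in the
    triangle inequality through z, and z is their midpoint. *)
Lemma long_pair_encloses P z p q : p \in P -> q \in P -> p != q ->
  2 * farthest_distance P z <= N (p - q) ->
  encloses N (two_point_disk N (p, q)) P.
Proof.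
move=> pP qP pq far; set r := farthest_distance P z in far.
have zp : N (p - z) <= r by rewrite norm_subC le_farthest.
have zq : N (z - q) <= r by rewrite le_farthest.
have r0 : 0 < r.
  have : 0 < N (p - q) by rewrite norm_gt0 // subr_eq0.
  by have := norm_path p z q; lra.
have : p - z = z - q by apply: (norm_add_eq r) => //; rewrite subrKA.
have rE : 2^-1 * N (p - q) = r by have := norm_path p z q; lra.
move=> e; have zE : 2^-1 *: (p + q) = z.
  have -> : p = z - q + z by rewrite -e subrK.
  by apply: plane_ext; rewrite !mxE; field.
by rewrite /two_point_disk /= zE rE; exact: encloses_farthest.
Qed.

(** With at most two defining points a and b, their distance would be at
    least twice the optimal radius and z would lie on an edge between their
    regions; a longest edge pair is then at least as far apart, so its
    two-point disk encloses P. *)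
Lemma center_is_vertex P z pq : P != fset0 ->
  (forall x, farthest_distance P z <= farthest_distance P x) ->
  longest_edge_pair N P pq -> ~ encloses N (two_point_disk N pq) P ->
  fpv_vertex N P z.
Proof.
move=> P0 zmin [[E [pq12 [x Dx _]]] pq_max] not_enc.
have defx s : s \in [fset pq.1; pq.2]%fset -> s \in P.
  by rewrite -Dx => /mem_defining_points[].
have pP : pq.1 \in P by apply: defx; rewrite in_fset2 eqxx.
have qP : pq.2 \in P by apply: defx; rewrite in_fset2 eqxx orbT.
rewrite /fpv_vertex ltnNge; apply/negP => D2; apply: not_enc.
have -> : pq = (pq.1, pq.2) by case: (pq).
apply: (long_pair_encloses P z) => //.
have [a aP za] := farthest_attained P z P0.
have Da : a \in defining_points N P z by apply/mem_defining_points.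
have [b Dab] : exists b : 'rV[R]_2, defining_points N P z = [fset a; b]%fset.
  have [D0|/fset0Pn[b]] := eqVneq (defining_points N P z `\ a)%fset fset0.
    by exists a; rewrite fsetUid -[LHS](fsetD1K Da) D0 fsetU0.
  rewrite in_fsetD1 => /andP[ba Db]; exists b.
  apply/esym/eqP; rewrite eqEfcard cardfs2 eq_sym ba D2 andbT.
  by apply/fsubsetP => s; rewrite in_fset2 => /orP[]/eqP->.
have far : 2 * farthest_distance P z <= N (a - b).
  apply: diametral_defining_points => // s.
  by rewrite Dab in_fset2 => /orP[]/eqP->; [left|right].
apply: le_trans far _; have [->|ab] := eqVneq a b.
  by rewrite subrr norm0 norm_ge0.
apply: (pq_max a b (connected_component (edge_locus N P a b) z)).
by split=> //; exists z.
Qed.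

End PlaneNorm.

Theorem theorem3p6 (R : realType) (N : 'rV[R]_2 -> R)
    (N_norm : is_norm N) (N_convex : strictly_convex N)
    (n : nat) (n_ge2 : (2 <= n)%N)
    (P : {fset 'rV[R]_2}) (card_P : #|` P| = n) :
  shamos_hoey_computes N P (minimal_enclosing_disk N P).
Proof.
rewrite -card_P in n_ge2 => {n card_P}.
have P0 : P != fset0 by rewrite -cardfs_gt0 ltnW.
have [z zmin] := farthest_distance_min R N N_norm P P0.
move=> c c_def; split; first exact: exists_longest_edge_pair.
have c_far v : fpv_vertex N P v -> N (v - c v) = farthest_distance R N P v.
  by move=> /c_def /(mem_defining_points _ _ N_norm)[].
move=> pq longest.
have [enc|not_enc] := pselect (encloses N (two_point_disk N pq) P).
  split; first by exists (two_point_disk N pq); split.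
  move=> D [/(_ enc)-> _].
  have [[E [_ [x Dx _]]] _] := longest.
  have defx s : s \in [fset pq.1; pq.2]%fset -> s \in P.
    by rewrite -Dx => /(mem_defining_points _ _ N_norm)[].
  apply: (minimal_two_point_disk _ _ N_norm P pq z) => //; apply: defx.
    by rewrite in_fset2 eqxx.
  by rewrite in_fset2 eqxx orbT.
(* The vertices have f v >= f z and z is one of them, so the nearest vertices
   are exactly the vertices where f attains its minimum. *)
have zv := center_is_vertex R N N_norm N_convex P z pq P0 zmin longest not_enc.
split.
  exists (z, N (z - c z)); split=> // _; split=> //= v vv.
  by rewrite !c_far.
move=> [x r] [_ /(_ not_enc)] [/= xv rE r_min].
have := r_min z zv; rewrite c_far // => rz.
have rx : r = farthest_distance R N P x by rewrite rE c_far.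
have rzE : r = farthest_distance R N P z.
  by apply/eqP; rewrite eq_le rz rx zmin.
split; first by rewrite (enclosing_radius_min R N P z).
by apply: encloses_farthest => //; rewrite rx.
Qed.
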